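(* Let $G$ be a uniquely divisible group, and let $w$ be a totally decomposable word. For any $A,B\in G$, the equation $w(X,A)=B$ has a unique solution $X\in G$, and this solution can be expressed in terms of radicals, i.e. it lies in the radical subgroup $\mathcal{R}(\{A,B\})$ of $G$ generated by $\{A,B\}$.
   Context: A group $G$ is uniquely divisible if for every $g\in G$ and each positive integer $m$ there exists a unique $h\in G$ with $h^m=g$, denoted $g^{1/m}$; for $q=n/m\in\mathbb{Q}$ with $n\in\mathbb{Z}$ and $m\ge1$ put $g^{q}:=(g^n)^{1/m}$ (this is well defined). Words are finite words in the alphabet $\{X,A\}$, and $w(g,a)$ denotes the element obtained by substituting $g$ for the letter $X$ and $a$ for the letter $A$. A word is totally decomposable if it is the image of the one-letter word $X$ under a (possibly empty) composition of maps on words of the following forms: $\pi_{m,k}:w\mapsto (wA^k)^m w$ for integers $m\ge 1$, $k\ge 0$; $r:w\mapsto wA$; $l:w\mapsto Aw$. For a subset $H$ of a uniquely divisible group $G$, set $R_0=H$ and $R_{n+1}=\{(xy)^q: x,y\in R_n,\ q\in\mathbb{Q}\}$; then $\mathcal{R}(H):=\bigcup_{n\ge 0}R_n$ is the radical subgroup of $G$ generated by $H$. *)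

(* Defs.v *)
From mathcomp Require Import all_boot all_order all_algebra.
From mathcomp Require Import classical_sets.

Set Implicit Arguments.
Unset Strict Implicit.
Unset Printing Implicit Defensive.

Import GRing.Theory Num.Theory.

Local Open Scope classical_set_scope.
Local Open Scope group_scope.

Definition uniquely_divisible (G : groupType) : Prop :=
  forall (g : G) (m : nat), (0 < m)%N -> exists! h : G, h ^+ m = g.

Section RationalPowers.
Variables (G : groupType) (divG : uniquely_divisible G).

Lemma root_exists (g : G) (m : nat) : (0 < m)%N -> exists h : G, h ^+ m == g.
Proof. by case/(divG g) => h [hm _]; exists h; apply/eqP. Qed.

Definition nth_root (g : G) (m : nat) (m_gt0 : (0 < m)%N) : G :=
  xchoose (root_exists g m_gt0).

Definition expgz (g : G) (n : int) : G :=
  match n with Posz k => g ^+ k | Negz k => g ^- k.+1 end.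

Lemma absz_denq_gt0 (q : rat) : (0 < `|denq q|)%N.
Proof. by rewrite absz_gt0 denq_neq0. Qed.

(* The fraction is taken in lowest terms; [expgq_frac] below shows that any
   other representation of the exponent gives the same power. *)
Definition expgq (g : G) (q : rat) : G :=
  nth_root (expgz g (numq q)) (absz_denq_gt0 q).

Lemma nth_rootK (g : G) (m : nat) (m_gt0 : (0 < m)%N) :
  nth_root g m_gt0 ^+ m = g.
Proof. exact/eqP/(xchooseP (root_exists g m_gt0)). Qed.

Lemma expg_inj (m : nat) : (0 < m)%N -> injective (fun g : G => g ^+ m).
Proof.
move=> m_gt0 g h /= gh; have [k [_ uk]] := divG (h ^+ m) m_gt0.
by rewrite -(uk g gh) -(uk h).
Qed.

Lemma expgzX (g : G) (n : int) (m : nat) : expgz g n ^+ m = expgz g (n * m%:Z)%R.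
Proof.
case: n => k; first by rewrite -PoszM /= expgnA.
case: m => [|m]; first by rewrite expg0 mulr0.
have -> : (Negz k * m.+1%:Z)%R = Negz (k.+1 * m.+1).-1.
  by rewrite !NegzE mulNr -PoszM prednK // muln_gt0.
by rewrite /expgz prednK ?muln_gt0 // -!expVgn expgnA.
Qed.

Lemma expgq_frac (g : G) (n : int) (m : nat) (m_gt0 : (0 < m)%N) :
  expgq g (n%:~R / m%:R)%R = nth_root (expgz g n) m_gt0.
Proof.
set q := (_ / _)%R.
have d_gt0 := absz_denq_gt0 q; have dE : Posz `|denq q|%N = denq q.
  by rewrite gez0_abs // denq_ge0.
apply: (@expg_inj (`|denq q| * m)); first by rewrite muln_gt0 d_gt0.
rewrite /= expgnA nth_rootK mulnC expgnA nth_rootK !expgzX dE; congr expgz.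
apply: (@intr_inj rat); rewrite !rmorphM /= numqE mulrAC.
by rewrite {1}/q mulfVK // pnatr_eq0 -lt0n.
Qed.

Fixpoint radical_level (H : set G) (n : nat) : set G :=
  match n with
  | 0 => H
  | k.+1 => [set z | exists x y (q : rat),
      [/\ radical_level H k x, radical_level H k y & z = expgq (x * y) q]]
  end.

Definition radical (H : set G) : set G := \bigcup_n radical_level H n.

End RationalPowers.

Inductive letter := LetterX | LetterA.

Definition word := seq letter.

Definition word_pi (m k : nat) (w : word) : word :=
  flatten (nseq m (w ++ nseq k LetterA)) ++ w.

Definition word_r (w : word) : word := rcons w LetterA.

Definition word_l (w : word) : word := LetterA :: w.

Inductive totally_decomposable : word -> Prop :=
  | td_X : totally_decomposable [:: LetterX]
  | td_pi (m k : nat) (w : word) : (1 <= m)%N ->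
      totally_decomposable w -> totally_decomposable (word_pi m k w)
  | td_r (w : word) :
      totally_decomposable w -> totally_decomposable (word_r w)
  | td_l (w : word) :
      totally_decomposable w -> totally_decomposable (word_l w).

Definition eval_word (G : groupType) (w : word) (g a : G) : G :=
  \prod_(c <- w) (match c with LetterX => g | LetterA => a end).

(* Main.v *)
Require Import Defs.
From mathcomp Require Import all_boot all_order all_algebra.
From mathcomp Require Import classical_sets.

(** Each of the three word operations can be undone by one explicit step. Put
    [v := eval_word w X A]. The equations [v A = B] and [A v = B] amount to
    [v = B A^-1] and [v = A^-1 B]. The equation [(v A^k)^m v = B] becomes, on
    multiplying both sides by [A^k] on the right, [(v A^k)^(m+1) = B A^k]; by
    unique divisibility it holds for exactly one [v], namely
    [v = (B A^k)^(1/(m+1)) A^-k]. So an equation for a decomposed word with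
    right-hand side [B] is equivalent to an equation for the shorter word with
    a new right-hand side, and induction on the decomposition ends with
    [X = X0].

    The radical set is closed under products, inverses, natural powers and
    roots, so every new right-hand side stays in it. Products are immediate
    from the definition. The other operations, and the inclusion of each level
    in the next, follow from [x = (x x)^(1/2)], which lets a single element
    play the role of a product. *)

Local Open Scope classical_set_scope.
Local Open Scope group_scope.

(** * Closure properties of the radical set *)

Lemma expgq_root (G : groupType) (divG : uniquely_divisible G) (g h : G)
    (n : int) (m : nat) :
  (0 < m)%N -> h ^+ m = expgz g n -> h = expgq divG g (n%:~R / m%:R)%R.
Proof.
move=> m_gt0 hm; rewrite (expgq_frac divG g n m_gt0).
by apply: (expg_inj divG m_gt0); rewrite /= nth_rootK.
Qed.

(** The chain of levels increases even when [1] is not in [H], because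
    [x = (x x)^(1/2)]. *)
Lemma radical_level_leq (G : groupType) (divG : uniquely_divisible G)
    (H : set G) (i j : nat) (x : G) :
  (i <= j)%N -> radical_level divG H i x -> radical_level divG H j x.
Proof.
move=> le_ij Hx; rewrite -(subnK le_ij); elim: (j - i)%N => [|d IHd] //.
rewrite addSn; exists x, x, (1%:~R / 2%:R)%R; split=> //.
by apply: expgq_root; rewrite //= expg1 expgS expg1.
Qed.

Lemma radical_gen (G : groupType) (divG : uniquely_divisible G)
    (H : set G) (x : G) :
  H x -> radical divG H x.
Proof. by move=> Hx; exists 0. Qed.

(** The defining closure property in usable form: [h] is the power of [x y]
    with exponent [n / m], which need not be in lowest terms. *)
Lemma radical_mul_root (G : groupType) (divG : uniquely_divisible G)
    (H : set G) (x y h : G) (n : int) (m : nat) :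
  (0 < m)%N -> radical divG H x -> radical divG H y ->
  h ^+ m = expgz (x * y) n -> radical divG H h.
Proof.
move=> m_gt0 [i _ Hx] [j _ Hy] hm; exists (maxn i j).+1 => //.
exists x, y, (n%:~R / m%:R)%R; split; last exact: expgq_root.
  by apply: radical_level_leq Hx; rewrite leq_maxl.
by apply: radical_level_leq Hy; rewrite leq_maxr.
Qed.

Lemma radicalM (G : groupType) (divG : uniquely_divisible G)
    (H : set G) (x y : G) :
  radical divG H x -> radical divG H y -> radical divG H (x * y).
Proof. by move=> Hx Hy; apply: (radical_mul_root _ _ _ x y _ 1 1). Qed.

Lemma radicalX (G : groupType) (divG : uniquely_divisible G)
    (H : set G) (x : G) (k : nat) :
  radical divG H x -> radical divG H (x ^+ k).
Proof.
move=> Hx; apply: (radical_mul_root _ _ _ x x _ k 2) => //=.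
by rewrite -expgnA mulnC expgnA.
Qed.

Lemma radicalV (G : groupType) (divG : uniquely_divisible G)
    (H : set G) (x : G) :
  radical divG H x -> radical divG H x^-1.
Proof.
move=> Hx; apply: (radical_mul_root _ _ _ x x _ (Negz 0) 2) => //=.
by rewrite expVgn.
Qed.

(** Writing [x = x^2 x^-1] gives the product that the definition asks for. *)
Lemma radical_root (G : groupType) (divG : uniquely_divisible G)
    (H : set G) (x h : G) (m : nat) :
  (0 < m)%N -> radical divG H x -> h ^+ m = x -> radical divG H h.
Proof.
move=> m_gt0 Hx hm.
apply: (radical_mul_root _ _ _ (x ^+ 2) x^-1 _ 1 m) => //.
- exact: radicalX.
- exact: radicalV.
by rewrite /= expg1 expgS expg1 mulgK.
Qed.

(** * Evaluation of the word operations *)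

Lemma eval_word_pi (G : groupType) (m k : nat) (w : word) (X A : G) :
  eval_word (word_pi m k w) X A =
    (eval_word w X A * A ^+ k) ^+ m * eval_word w X A.
Proof.
rewrite /eval_word /word_pi big_cat /=; congr (_ * _).
have evalAk : eval_word (nseq k LetterA) X A = A ^+ k.
  rewrite /eval_word; elim: k => [|k IHk]; first by rewrite big_nil expg0.
  by rewrite big_cons IHk expgS.
elim: m => [|m IHm]; first by rewrite big_nil expg0.
by rewrite /= 2!big_cat /= IHm [X in _ * X * _]evalAk expgS.
Qed.

Lemma eval_word_r (G : groupType) (w : word) (X A : G) :
  eval_word (word_r w) X A = eval_word w X A * A.
Proof. by rewrite /eval_word /word_r -cats1 big_cat /= big_seq1. Qed.

Lemma eval_word_l (G : groupType) (w : word) (X A : G) :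
  eval_word (word_l w) X A = A * eval_word w X A.
Proof. by rewrite /eval_word big_cons. Qed.

(** * Solving the equation *)

(** Here [c] stands for [A ^+ k]: multiplying [(v c)^m v = b] by [c] on the
    right turns the left-hand side into a perfect power. *)
Lemma pi_equation (G : groupType) (divG : uniquely_divisible G)
    (m : nat) (v c b h : G) :
  h ^+ m.+1 = b * c -> ((v * c) ^+ m * v = b <-> v = h * c^-1).
Proof.
move=> hm; split=> [vb|->].
  suff -> : h = v * c by rewrite mulgK.
  by apply: (expg_inj divG (ltn0Sn m)); rewrite /= hm -vb expgSr mulgA.
by rewrite mulgVK mulgA -expgSr hm mulgK.
Qed.

(** The right-hand side ranges over the whole radical set, because each step of
    the induction replaces it by another element of that set. *)
Lemma radical_solution (G : groupType) (divG : uniquely_divisible G)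
    (H : set G) (w : word) (A B : G) :
  totally_decomposable w -> radical divG H A -> radical divG H B ->
  exists2 X0 : G, radical divG H X0 &
    forall X : G, eval_word w X A = B <-> X = X0.
Proof.
move=> tdw HA; elim: tdw B => [|m k u _ _ IHu|u _ IHu|u _ IHu] B HB.
- by exists B => // X; rewrite /eval_word big_seq1.
- have [h [hm _]] := divG (B * A ^+ k) m.+1 (ltn0Sn m).
  have HAk := radicalX G divG H A k HA.
  have Hh : radical divG H h.
    by apply: (radical_root _ _ _ _ _ m.+1 _ _ hm) => //; apply: radicalM.
  have [|X0 HX0 solX0] := IHu (h * (A ^+ k)^-1).
    by apply: radicalM => //; apply: radicalV.
  exists X0 => // X; rewrite eval_word_pi.
  exact: iff_trans (pi_equation _ divG _ _ _ _ _ hm) (solX0 X).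
- have [|X0 HX0 solX0] := IHu (B * A^-1).
    by apply: radicalM => //; apply: radicalV.
  exists X0 => // X; rewrite eval_word_r; apply: iff_trans (solX0 X).
  by split=> [<-|->]; rewrite ?mulgK ?mulgVK.
have [|X0 HX0 solX0] := IHu (A^-1 * B).
  by apply: radicalM => //; apply: radicalV.
exists X0 => // X; rewrite eval_word_l; apply: iff_trans (solX0 X).
by split=> [<-|->]; rewrite ?mulKg ?mulVKg.
Qed.

Theorem lemma1p3 (G : groupType) (divG : uniquely_divisible G)
    (w : word) (tdw : totally_decomposable w) (A B : G) :
  (exists! X : G, eval_word w X A = B) /\
  (forall X : G, eval_word w X A = B -> radical divG [set A; B] X).
Proof.
have HA : radical divG [set A; B] A by apply: radical_gen; left.
have HB : radical divG [set A; B] B by apply: radical_gen; right.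
have [X0 HX0 solX0] := radical_solution _ _ _ _ _ _ tdw HA HB.
split=> [|X /solX0 -> //].
by exists X0; split=> [|X /solX0 ->] //; apply/solX0.
Qed.
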